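(* Let $\mathcal M$ be the (infinitely branching, countable) MDP with controlled states $s$ and $t$ and random states $r_i$ ($i\ge1$), and with the following transitions and rewards: $s\to r_i$ for every $i\ge 1$ with reward $0$; from $r_i$ the successor is $t$ with probability $2^{-i}$ and $s$ with probability $1-2^{-i}$, where $r_i\to t$ has reward $-1$ and $r_i\to s$ has reward $0$; and $t\to s$ with reward $+1$. Let $\varphi$ be the event that the $\liminf$ of the sequence of transition rewards seen along the run is $\ge 0$. Then: (1) every randomized finite-memory strategy $\sigma$ satisfies $\mathcal P_{\mathcal M,s,\sigma}(\varphi)=0$; (2) there exists a strategy $\sigma$ with $\mathcal P_{\mathcal M,s,\sigma}(\varphi)=1$. Hence optimal (and even almost-surely winning) strategies and $\varepsilon$-optimal strategies for this objective require infinite memory.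
   Context: In an MDP the player chooses the successor at controlled states, while at random states the successor is drawn from the given distribution. A history is a finite path ending in a controlled state; a (general) strategy $\sigma$ maps each history ending in a state $q$ to a probability distribution on the successors of $q$; together with the start state it induces a probability measure $\mathcal P_{\mathcal M,s,\sigma}$ on infinite runs from $s$. A randomized finite-memory (FR) strategy is given by a finite set $\mathsf M$ of memory modes, an initial mode, a function choosing at controlled states a probability distribution over successors depending only on the current state and the current mode, and a function choosing, after each step from $q$ to $q'$ (from controlled or random $q$), a probability distribution over the next mode depending only on the current mode, $q$ and $q'$. A strategy is $\varepsilon$-optimal if it attains $\varphi$ with probability at least the value (the supremum over all strategies) minus $\varepsilon$. *)

(* Defs.v *)
From HB Require Import structures.
From mathcomp Require Import all_boot all_order all_algebra.
From mathcomp Require Import all_classical all_reals all_analysis.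
From mathcomp Require Import measurable_realfun.
Set Implicit Arguments.
Unset Strict Implicit.
Unset Printing Implicit Defensive.
Import Order.TTheory GRing.Theory Num.Theory numFieldNormedType.Exports.
Local Open Scope classical_set_scope.
Local Open Scope ring_scope.

Definition distribution (R : realType) (S : countType) (A : pred S)
    (p : S -> R) : Prop :=
  [/\ forall q, 0 <= p q, forall q, ~~ A q -> p q = 0
    & (\esum_(q in [set: S]) (p q)%:E = 1)%E].

(** States that are not [controlled] are random; [prob] is only constrained,
    and only used, at random states, and [reward] only on transitions. *)
Record mdp (R : realType) := Mdp {
  state : countType;
  controlled : pred state;
  trans : rel state;
  prob : state -> state -> R;
  reward : state -> state -> R;
  trans_total : forall q, exists q', trans q q';
  probP : forall q, ~~ controlled q -> distribution (trans q) (prob q) }.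

Arguments state {R}.
Arguments controlled {R M} q : rename.
Arguments trans {R M} q q' : rename.
Arguments prob {R M} q q' : rename.
Arguments reward {R M} q q' : rename.

(** The finite path [q :: w] is passed as the pair of arguments [q], [w]; it is
    a history when [path trans q w] and its end state [last q w] is controlled.
    The value of a strategy outside histories is irrelevant. *)
Record strategy (R : realType) (M : mdp R) := Strategy {
  act :> state M -> seq (state M) -> state M -> R;
  actP : forall q w, path trans q w -> controlled (last q w) ->
    distribution (trans (last q w)) (act q w) }.

Record run (R : realType) (M : mdp R) (s : state M) := Run {
  run_at :> nat -> state M;
  run_start : run_at 0%N = s;
  run_trans : forall n, trans (run_at n) (run_at n.+1) }.

Section RunSpace.
Variables (R : realType) (M : mdp R) (s : state M).

Lemma run_ex : exists rho : run s, True.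
Proof.
have [f fP] := choice (@trans_total R M).
by exists (@Run R M s (fun n => iter n f s) erefl (fun n => fP _)).
Qed.

HB.instance Definition _ := gen_eqMixin (run s).
HB.instance Definition _ := gen_choiceMixin (run s).
HB.instance Definition _ := isPointed.Build (run s) (sval (cid run_ex)).

Definition cylinder (w : seq (state M)) : set (run s) :=
  [set rho | mkseq rho (size w).+1 = s :: w].

Definition run_space := g_sigma_algebraType (range cylinder).

HB.instance Definition _ := Measurable.on run_space.

End RunSpace.

Arguments cylinder {R M} s w.

Section Cumulative.
Variables (R : realType) (S : countType) (A : pred S) (p : S -> R).
Hypothesis dp : distribution A p.

Let mass k : R := oapp p 0 (pickle_inv k).
Let cumul n : R := \sum_(k < n) mass k.

Let mass_ge0 k : 0 <= mass k.
Proof. by rewrite /mass; case: pickle_inv => //= q; case: dp. Qed.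

Let massE q : mass (pickle q) = p q.
Proof. by rewrite /mass pickleK_inv. Qed.

Let cumulS n : cumul n.+1 = cumul n + mass n.
Proof. by rewrite /cumul big_ord_recr. Qed.

Let cumul_mono m n : (m <= n)%N -> cumul m <= cumul n.
Proof.
elim: n => [|n IH]; first by rewrite leqn0 => /eqP ->.
rewrite leq_eqVlt => /predU1P[-> //|]; rewrite ltnS => /IH h.
by rewrite cumulS ler_wpDr.
Qed.

Let mass_series : (\sum_(k <oo) (mass k)%:E = 1)%E.
Proof.
case: dp => p0 _ <-.
rewrite nneseries_esumT; last by move=> n; rewrite lee_fin.
rewrite (esumID (range (@pickle S))); last by move=> i _; rewrite lee_fin.
rewrite !setTI [X in (_ + X)%E]esum1 ?adde0.
- rewrite esum_image; last by move=> x y _ _; exact: (pcan_inj pickleK_inv).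
  by apply: eq_esum => q _; rewrite massE.
- move=> k nk; congr (_%:E); rewrite /mass; case E: (pickle_inv k) => [q|] //=.
  by case: nk; exists q => //; have := @pickle_invK S k; rewrite E.
Qed.

Let cumul_le1 n : cumul n <= 1.
Proof.
rewrite -lee_fin -mass_series /cumul -sumEFin -(big_mkord xpredT (fun k => (mass k)%:E)).
by apply: nneseries_lim_ge => k _ _; rewrite lee_fin.
Qed.

Let cumul_gt v : v < 1 -> exists n, v < cumul n.
Proof.
move=> v1; apply: contrapT => /forallNP h; move: v1; apply/negP; rewrite -leNgt.
rewrite -lee_fin -mass_series; apply: lime_le.
  by apply: is_cvg_nneseries => k _ _; rewrite lee_fin.
apply: nearW => n; rewrite big_mkord sumEFin lee_fin leNgt; apply/negP.
exact: h.
Qed.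

Definition cumulative (q : S) : R :=
  \sum_(k < pickle q) oapp p 0 (@pickle_inv S k).

Lemma cumulative_ge0 q : 0 <= cumulative q.
Proof. by apply: sumr_ge0 => k _; exact: mass_ge0. Qed.

Lemma cumulative_le1 q : cumulative q + p q <= 1.
Proof. by rewrite -massE -cumulS. Qed.

Lemma cumulative_ex v : 0 <= v < 1 ->
  exists q, cumulative q <= v < cumulative q + p q.
Proof.
move=> /andP[v0 /cumul_gt ex]; case: (ex_minnP ex) => -[|k].
  by rewrite /cumul big_ord0 ltNge v0.
rewrite cumulS => vk mk.
have ck : cumul k <= v.
  by rewrite leNgt; apply/negP => /mk; rewrite ltnn.
have : 0 < mass k by rewrite -(ltrD2l (cumul k)) addr0; exact: le_lt_trans vk.
rewrite {1}/mass; case E: (pickle_inv k) => [q|]; last by rewrite ltxx.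
have := @pickle_invK S k; rewrite E /= => Ek _.
by exists q; rewrite -massE /cumulative Ek ck vk.
Qed.

Lemma cumulative_uniq v q q' : cumulative q <= v < cumulative q + p q ->
  cumulative q' <= v < cumulative q' + p q' -> q = q'.
Proof.
have aux a b : (pickle a < pickle b)%N -> v < cumulative a + p a ->
    cumulative b <= v -> False.
  move=> /cumul_mono; rewrite cumulS massE => h1 h2 h3.
  by have := lt_le_trans (lt_le_trans h2 h1) h3; rewrite ltxx.
move=> /andP[q1 q2] /andP[q1' q2']; case: (ltngtP (pickle q) (pickle q')).
- by move=> /aux; case/(_ q2 q1').
- by move=> /aux; case/(_ q2' q1).
- exact: (pcan_inj pickleK_inv).
Qed.

End Cumulative.

(** Inverse transform sampling: a number [u] in [0, 1[ is mapped to the run whose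
    finite prefixes [s :: w] are those with [u] in [path_itv w]. These half-open
    intervals have length [path_weight w] and are nested; it yields the existence
    of the measure on runs from Lebesgue measure. *)
Section PathLaw.
Variables (R : realType) (S : countType) (s : S) (K : seq S -> S -> R).

Definition path_weight (w : seq S) : R :=
  \prod_(i < size w) K (take i w) (nth s w i).

Lemma path_weight_nil : path_weight [::] = 1.
Proof. by rewrite /path_weight big_ord0. Qed.

Lemma path_weight_rcons w q : path_weight (rcons w q) = path_weight w * K w q.
Proof.
rewrite /path_weight size_rcons big_ord_recr /=; congr (_ * _).
  apply: eq_bigr => i _; rewrite nth_rcons ltn_ord; congr K.
  by rewrite -cats1 takel_cat // ltnW.
by rewrite -cats1 take_size_cat // nth_cat ltnn subnn.
Qed.

Hypothesis K_distr : forall w, 0 < path_weight w ->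
  distribution predT (K w).

Lemma path_weight_ge0 w : 0 <= path_weight w.
Proof.
elim/last_ind: w => [|w q IH]; first by rewrite path_weight_nil.
rewrite path_weight_rcons; move: IH; rewrite le_eqVlt => /predU1P[<-|w0].
  by rewrite mul0r.
by rewrite mulr_ge0 // ?(ltW w0) //; case: (K_distr w0).
Qed.

Fixpoint left_end_aux (pre w : seq S) : R :=
  if w is q :: w' then
    path_weight pre * cumulative (K pre) q + left_end_aux (rcons pre q) w'
  else 0.
Definition left_end w := left_end_aux [::] w.

Lemma left_end_rcons w q :
  left_end (rcons w q) = left_end w + path_weight w * cumulative (K w) q.
Proof.
rewrite /left_end -[w in path_weight w]cat0s -[w in cumulative (K w)]cat0s.
elim: w [::] => [|x w IH] pre /=; first by rewrite cats0 addr0 add0r.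
by rewrite IH cat_rcons addrA.
Qed.

Definition path_itv w : set R :=
  [set u | left_end w <= u < left_end w + path_weight w].

Lemma path_itv_gt0 w u : path_itv w u -> 0 < path_weight w.
Proof.
by rewrite /path_itv /= => /andP[a b]; rewrite -(ltrD2l (left_end w)) addr0 (le_lt_trans a).
Qed.

Let itv_scale w q u : 0 < path_weight w -> path_itv (rcons w q) u <->
  cumulative (K w) q <= (u - left_end w) / path_weight w
    < cumulative (K w) q + K w q.
Proof.
move=> w0; rewrite /path_itv /= left_end_rcons path_weight_rcons.
rewrite ler_pdivlMr // ltr_pdivrMr // lerBrDl ltrBlDl.
by rewrite -addrA -mulrDr ![_ * path_weight w]mulrC.
Qed.

Lemma path_itv_sub w q : path_itv (rcons w q) `<=` path_itv w.
Proof.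
move=> u uI.
have := path_itv_gt0 uI; rewrite path_weight_rcons => wK.
have w0 : 0 < path_weight w.
  by rewrite lt_neqAle path_weight_ge0 andbT eq_sym; apply: contraTneq wK => ->; rewrite mul0r ltxx.
move: uI => /(itv_scale _ _ w0) /andP[h1 h2].
have := le_trans (cumulative_ge0 (K_distr w0) q) h1.
have := lt_le_trans h2 (cumulative_le1 (K_distr w0) q).
rewrite ler_pdivlMr // ltr_pdivrMr // mul0r mul1r subr_ge0 ltrBlDl => a b.
by rewrite /path_itv /= b a.
Qed.

Lemma path_itv_split w u : path_itv w u -> exists q, path_itv (rcons w q) u.
Proof.
move=> uI; have w0 := path_itv_gt0 uI; move: uI; rewrite /path_itv /= => /andP[a b].
have h : 0 <= (u - left_end w) / path_weight w < 1.
  by rewrite ler_pdivlMr // ltr_pdivrMr // mul0r mul1r subr_ge0 a ltrBlDl.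
by have [q qP] := cumulative_ex (K_distr w0) h; exists q; apply/(itv_scale _ _ w0).
Qed.

Lemma path_itv_uniq w w' u : size w = size w' -> path_itv w u ->
  path_itv w' u -> w = w'.
Proof.
elim/last_ind: w w' => [|w q IH] w'; first by case: w'.
case/lastP: w' => [|w' q']; first by rewrite size_rcons.
rewrite !size_rcons => -[sw] uI uI'.
have ? := IH w' sw (path_itv_sub uI) (path_itv_sub uI'); subst w'.
have w0 := path_itv_gt0 (path_itv_sub uI).
congr rcons; move: uI uI' => /(itv_scale _ _ w0) h /(itv_scale _ _ w0).
exact: (cumulative_uniq (K_distr w0) h).
Qed.

Fixpoint sample_path u n : seq S :=
  if n is n'.+1 then
    rcons (sample_path u n') (xget s [set q | path_itv (rcons (sample_path u n') q) u])
  else [::].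

Lemma size_sample_path u n : size (sample_path u n) = n.
Proof. by elim: n => //= n IH; rewrite size_rcons IH. Qed.

Lemma path_itv_nil u : path_itv [::] u <-> 0 <= u < 1.
Proof. by rewrite /path_itv /= path_weight_nil /left_end /= add0r. Qed.

Lemma sample_path_itv u n : 0 <= u < 1 -> path_itv (sample_path u n) u.
Proof.
move=> u01; elim: n => [|n IH] /=; first exact/path_itv_nil.
have [q qP] := path_itv_split IH.
exact: (@xgetPex _ s [set q | path_itv (rcons (sample_path u n) q) u] (ex_intro _ q qP)).
Qed.

Definition sample_run u (n : nat) : S := last s (sample_path u n).

Lemma mkseq_sample_run u n : mkseq (sample_run u) n.+1 = s :: sample_path u n.
Proof.
elim: n => [|n IH]; first by [].
by rewrite mkseqS IH /= /sample_run /= last_rcons.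
Qed.

Lemma sample_run_prefix w u : 0 <= u < 1 ->
  (mkseq (sample_run u) (size w).+1 = s :: w) <-> path_itv w u.
Proof.
move=> u01; rewrite mkseq_sample_run; split=> [[<-]|uI].
  by rewrite -{1}(size_sample_path u (size w)) size_sample_path; exact: sample_path_itv.
congr cons; apply: (path_itv_uniq (size_sample_path _ _)) uI.
exact: sample_path_itv.
Qed.

Lemma path_itv_sub01 w u : path_itv w u -> 0 <= u < 1.
Proof.
elim/last_ind: w => [/path_itv_nil//|w q IH] /path_itv_sub; exact: IH.
Qed.

Lemma path_itvE w :
  path_itv w = [set` `[left_end w, left_end w + path_weight w[ ].
Proof. by apply/seteqP; split=> u; rewrite /path_itv /= in_itv. Qed.

End PathLaw.

Section Law.
Variables (R : realType) (M : mdp R).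
Implicit Types (sigma : strategy M) (s : state M) (w : seq (state M)).

Definition next_prob sigma s w : state M -> R :=
  if controlled (last s w) then sigma s w else prob (last s w).

Definition path_prob sigma s w : R :=
  \prod_(i < size w) next_prob sigma s (take i w) (nth s w i).

Definition run_law sigma s (P : probability (run_space s) R) : Prop :=
  forall w, P (cylinder s w) = (path_prob sigma s w)%:E.

Lemma path_prob_nil sigma s : path_prob sigma s [::] = 1.
Proof. exact: path_weight_nil. Qed.

Lemma path_prob_rcons sigma s w q :
  path_prob sigma s (rcons w q) = path_prob sigma s w * next_prob sigma s w q.
Proof. exact: path_weight_rcons. Qed.

Lemma next_prob_distr sigma s w : path trans s w ->
  distribution (trans (last s w)) (next_prob sigma s w).
Proof.
rewrite /next_prob => sw; case: ifPn => c; last exact: probP.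
exact: actP.
Qed.

Lemma path_prob_path sigma s w : path_prob sigma s w != 0 -> path trans s w.
Proof.
elim/last_ind: w => // w q IH; rewrite path_prob_rcons mulf_eq0 negb_or.
move=> /andP[/IH sw]; rewrite rcons_path sw /=.
by apply: contraNT => sq; have [_ -> //] := next_prob_distr sigma sw.
Qed.

Let K_distr sigma s w : 0 < path_weight s (next_prob sigma s) w ->
  distribution predT (next_prob sigma s w).
Proof.
move=> w0; have sw : path trans s w by apply: (@path_prob_path sigma); exact: lt0r_neq0.
by have [? _ ?] := next_prob_distr sigma sw; split.
Qed.

Lemma path_prob_ge0 sigma s w : 0 <= path_prob sigma s w.
Proof. exact: (path_weight_ge0 (@K_distr sigma s)). Qed.

Section Existence.
Variables (sigma : strategy M) (s : state M).
Let K := next_prob sigma s.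

Let sample_ex (u : R) : exists rho : run s,
  if 0 <= u < 1 then forall n, rho n = sample_run s K u n else rho = point.
Proof.
have [u01|u01] := boolP (0 <= u < 1); last by exists point.
have up n : path trans s (sample_path s K u n).
  apply: (@path_prob_path sigma); apply: lt0r_neq0.
  exact: (path_itv_gt0 (sample_path_itv (@K_distr sigma s) n u01)).
suff st n : trans (sample_run s K u n) (sample_run s K u n.+1).
  by exists (@Run R M s (sample_run s K u) erefl st).
by have := up n.+1; rewrite /= rcons_path /sample_run /= last_rcons => /andP[].
Qed.

Let sample (u : measurableTypeR R) : run_space s := sval (cid (sample_ex u)).

Let unit_itv : set (measurableTypeR R) := [set` `[0 : R, 1[ ].

Let sample_cylinder w : sample @^-1` cylinder s w =
  path_itv s K w `|` (if `[< cylinder s w point >] then ~` unit_itv else set0).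
Proof.
apply/seteqP; split=> u /=; rewrite /sample; case: cid => rho /= h.
- have [u01|u01] := boolP (0 <= u < 1); rewrite ?u01 ?(negbTE u01) in h.
    move=> c; left; apply/(sample_run_prefix (@K_distr sigma s) _ u01).
    by rewrite -c; apply: eq_mkseq => n; rewrite h.
  rewrite h => c; right; rewrite asboolT // /unit_itv /= in_itv /=.
  exact/negP.
- move=> [uI|].
    have u01 := path_itv_sub01 (@K_distr sigma s) uI; rewrite u01 in h.
    change (mkseq rho (size w).+1 = s :: w).
    move/(sample_run_prefix (@K_distr sigma s) _ u01) : uI => <-.
    by apply: eq_mkseq => n; rewrite h.
  case: asboolP => // c; rewrite /unit_itv /= in_itv /= => /negP u01.
  by rewrite (negbTE u01) in h; rewrite h.
Qed.

Let munit : measurable unit_itv. Proof. exact: measurable_itv. Qed.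

Let mpath_itv w : measurable (path_itv s K w : set (measurableTypeR R)).
Proof. by rewrite path_itvE; exact: measurable_itv. Qed.

Let msample : measurable_fun [set: measurableTypeR R] sample.
Proof.
have h := @measurability _ _ (measurableTypeR R) (run_space s) setT sample (range (cylinder s)) erefl.
apply: h.
move=> _ [_ [w _ <-] <-]; rewrite setTI sample_cylinder.
apply: measurableU => //; case: asboolP => _ //; exact: measurableC.
Qed.

Let law : set (run_space s) -> \bar R :=
  pushforward (mrestr lebesgue_measure munit) sample.

Let law0 : law set0 = 0%E.
Proof. exact: measure0. Qed.
Let law_ge0 A : (0 <= law A)%E.
Proof. exact: measure_ge0. Qed.
Let law_sigma_additive : semi_sigma_additive law.
Proof.
exact: (@measure_semi_sigma_additive _ _ _ (pushforward (mrestr lebesgue_measure munit) sample)).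
Qed.
HB.instance Definition _ := isMeasure.Build _ _ _ law
  law0 law_ge0 law_sigma_additive.

Let lawT : law setT = 1%E.
Proof.
rewrite /law /pushforward /= /mrestr preimage_setT setTI /unit_itv.
by rewrite lebesgue_measure_itv /= lte_fin ltr01 sube0.
Qed.
HB.instance Definition _ := Measure_isProbability.Build _ _ _ law lawT.

Let law_cylinder w : law (cylinder s w) = (path_prob sigma s w)%:E.
Proof.
rewrite /law /pushforward /= /mrestr sample_cylinder setIUl.
rewrite [X in _ `|` X](_ : _ = set0) ?setU0; last first.
  by case: asboolP => _; rewrite ?setICl ?set0I.
rewrite setIidl; last first.
  by move=> u /(path_itv_sub01 (@K_distr sigma s)); rewrite /unit_itv /= in_itv.
rewrite path_itvE lebesgue_measure_itv /= lte_fin.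
rewrite -{1}[left_end _ _ _]addr0 ltrD2l.
rewrite -[path_weight _ _ _]/(path_prob sigma s w).
have := path_prob_ge0 sigma s w; rewrite le_eqVlt => /predU1P[w0|w0].
  by rewrite -w0 ltxx.
by rewrite w0 -EFinD addrAC subrr add0r.
Qed.

Lemma run_law_ex : exists P : probability (run_space s) R, run_law sigma P.
Proof. by exists law => w; exact: law_cylinder. Qed.

End Existence.

(** The probability measure on runs from [s] induced by [sigma]: by
    [run_law_unique] it is determined by [run_prob_cylinder]. *)
Definition run_prob sigma s : probability (run_space s) R :=
  sval (cid (run_law_ex sigma s)).

Lemma run_prob_cylinder sigma s w :
  run_prob sigma s (cylinder s w) = (path_prob sigma s w)%:E.
Proof. exact: (svalP (cid (run_law_ex sigma s))). Qed.

Lemma cylinder_nil s : cylinder s [::] = setT.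
Proof.
apply/seteqP; split=> // rho _; change (mkseq rho 1 = [:: s]).
by rewrite /mkseq /= run_start.
Qed.

Lemma measurable_cylinder s w : measurable (cylinder s w : set (run_space s)).
Proof. by apply: sub_sigma_algebra; exists w. Qed.

Lemma run_law_unique sigma s (P Q : probability (run_space s) R) :
  run_law sigma P -> run_law sigma Q ->
  forall A : set (run_space s), measurable A -> P A = Q A.
Proof.
move=> hP hQ; pose G : set (set (run_space s)) := set0 |` range (cylinder s).
have mG : @measurable _ (run_space s) = <<s G >>.
  apply/seteqP; split.
    apply: smallest_sub; first exact: (@smallest_sigma_algebra _ setT G).
    by move=> A GA; apply: sub_sigma_algebra; right.
  apply: smallest_sub; first exact: smallest_sigma_algebra.
  move=> A [->|GA]; last exact: sub_sigma_algebra.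
  exact: sigma_algebra0.
have setIG : setI_closed G.
  move=> A B [->|[w _ <-]]; first by rewrite set0I; left.
  case=> [->|[w' _ <-]]; first by rewrite setI0; left.
  wlog ww : w w' / (size w <= size w')%N.
    by move=> h; case: (leqP (size w) (size w')) => [/h//|/ltnW/h]; rewrite setIC.
  have take_mkseq (rho : run s) :
      take (size w).+1 (mkseq rho (size w').+1) = mkseq rho (size w).+1.
    by rewrite /mkseq -map_take take_iota (minn_idPl _) // ltnS.
  have [e|ne] := eqVneq (take (size w) w') w.
    right; exists w' => //; rewrite setIidr // => rho h.
    change (mkseq rho (size w).+1 = s :: w).
    by rewrite -take_mkseq h /= e.
  left; apply/seteqP; split=> // rho [h1 h2]; move: ne => /eqP; apply.
  have := take_mkseq rho; rewrite h1 h2 /= => -[].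
  by [].
have GT : G setT by right; exists [::] => //; exact: cylinder_nil.
apply: (measure_unique G (fun=> setT) mG setIG (fun=> GT)).
- by apply: bigcup_const; exists 0%N.
- move=> A [->|[w _ <-]]; first by rewrite !measure0.
  exact: etrans (hP w) (esym (hQ w)).
- move=> _; apply: (@le_lt_trans _ _ 1%E); last exact: ltry.
  exact: probability_le1.
Qed.

End Law.

Section Objective.
Variables (R : realType) (M : mdp R) (s : state M).

Definition liminf_reward_ge0 : set (run_space s) :=
  [set rho : run s |
    (0 <= limn_einf (fun n => (reward (rho n) (rho n.+1))%:E))%E].

Lemma measurable_prefix n (Q : set (seq (state M))) :
  measurable ([set rho : run s | Q (mkseq rho n.+1)] : set (run_space s)).
Proof.
have -> : [set rho : run s | Q (mkseq rho n.+1)] =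
    \bigcup_(w in [set w | size w = n /\ Q (s :: w)]) cylinder s w.
  apply/seteqP; split=> rho; last first.
    case=> w [/= sw Qw] h; change (Q (mkseq rho n.+1)).
    by rewrite -sw; rewrite /cylinder /= in h *; rewrite h.
  move=> Qr; change (Q (mkseq rho n.+1)) in Qr.
  have e : mkseq rho n.+1 = s :: behead (mkseq rho n.+1).
    by rewrite /mkseq /= run_start.
  have sz : size (behead (mkseq rho n.+1)) = n by rewrite size_behead size_mkseq.
  exists (behead (mkseq rho n.+1)); first by split; rewrite -?e.
  by rewrite /cylinder /= sz -e.
rewrite bigcup_mkcond; apply: countable_bigcupT_measurable => [|w].
  exact: countableP.
by case: ifP => _ //; exact: measurable_cylinder.
Qed.

Lemma measurable_liminf_reward_ge0 : measurable liminf_reward_ge0.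
Proof.
pose r n (rho : run_space s) : \bar R :=
  (reward ((rho : run s) n) ((rho : run s) n.+1))%:E.
have mr n : measurable_fun [set: run_space s] (r n).
  move=> _ B mB; rewrite setTI.
  have -> : r n @^-1` B = [set rho : run s |
      [set w | B (reward (nth s w n) (nth s w n.+1))%:E] (mkseq rho n.+2)].
    by apply/seteqP; split=> rho; rewrite /preimage /r /mkset !nth_mkseq.
  exact: measurable_prefix.
have ml : measurable_fun [set: run_space s] (fun rho => limn_einf (r ^~ rho)).
  apply: measurableT_comp => //; apply: measurable_fun_limn_esup => n.
  exact: measurableT_comp.
have := emeasurable_fun_c_infty measurableT ml 0%E.
by rewrite setTI.
Qed.

Variable E : set (run_space s).

Definition value : \bar R := ereal_sup [set run_prob sigma s E | sigma in setT].

Definition almost_surely_winning (sigma : strategy M) : Prop :=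
  run_prob sigma s E = 1%E.

Definition eps_optimal (eps : R) (sigma : strategy M) : Prop :=
  (value - eps%:E <= run_prob sigma s E)%E.

Definition optimal (sigma : strategy M) : Prop :=
  run_prob sigma s E = value.

End Objective.

Record fr_memory (R : realType) (M : mdp R) := FrMemory {
  mode : finType;
  init_mode : mode;
  choose : mode -> state M -> state M -> R;
  update : mode -> state M -> state M -> mode -> R;
  chooseP : forall m q, controlled q -> distribution (trans q) (choose m q);
  updateP : forall m q q', trans q q' ->
    distribution predT (update m q q') }.

Lemma esum_mulr (R : realType) (S : choiceType) (c : R) (a : S -> R) :
  0 <= c -> (forall x, 0 <= a x) ->
  (\esum_(x in [set: S]) (c * a x)%:E = c%:E * \esum_(x in [set: S]) (a x)%:E)%E.
Proof.
have le_c (d : R) (b : S -> R) : 0 <= d -> (forall x, 0 <= b x) ->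
    (\esum_(x in [set: S]) (d * b x)%:E <= d%:E * \esum_(x in [set: S]) (b x)%:E)%E.
  move=> d0 b0; apply: ge_ereal_sup => _ [X [finX _] <-].
  under eq_fsbigr do rewrite EFinM.
  rewrite -ge0_mule_fsumr; last by move=> x; rewrite lee_fin.
  by apply: lee_wpmul2l; rewrite ?lee_fin //; apply: ereal_sup_ubound; exists X.
move=> c0 a0; have [->|cn0] := eqVneq c 0.
  by rewrite mul0e esum1 // => x _; rewrite mul0r.
have cp : 0 < c by rewrite lt_neqAle eq_sym cn0.
apply/eqP; rewrite eq_le le_c //=.
have := le_c c^-1 (fun x => c * a x); rewrite invr_ge0 => /(_ c0) h.
have {}h := h (fun x => mulr_ge0 c0 (a0 x)).
apply: (@le_trans _ _ (c%:E * (c^-1%:E * \esum_(x in [set: S]) (c * a x)%:E))%E).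
  apply: lee_wpmul2l; first by rewrite lee_fin.
  apply: le_trans h; rewrite le_eqVlt; apply/orP; left; apply/eqP.
  by apply: eq_esum => x _; rewrite mulKf.
by rewrite muleA -EFinM divff // mul1e.
Qed.

Lemma esum_finType (R : realType) (I : finType) (a : I -> R) :
  (forall i, 0 <= a i) -> (\esum_(i in [set: I]) (a i)%:E = (\sum_i a i)%:E)%E.
Proof.
move=> a0; have := @esum_fset R I setT (fun i => (a i)%:E) finite_finset.
move=> ->; last by move=> i _; rewrite lee_fin.
rewrite fsbig_finite ?finite_finset //= -sumEFin; apply: perm_big.
apply: uniq_perm => [||i]; [exact: finmap.fset_uniq|exact: index_enum_uniq|].
rewrite mem_index_enum in_fset_set; last exact: finite_finset.
by apply: mem_set.
Qed.

Section FiniteMemory.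
Variables (R : realType) (M : mdp R) (T : fr_memory M).
Implicit Types (q : state M) (w : seq (state M)) (m : mode T).

Definition mode_next_prob m q : state M -> R :=
  if controlled q then choose m q else prob q.

(** [mode_weight q w m] is the probability, in the Markov chain on pairs of a
    state and a mode started at [q] in the initial mode, that the states visited
    first are [q :: w] and that the mode reached then is [m]. *)
Fixpoint mode_weight_from (q : state M) (a : mode T -> R) (w : seq (state M))
    : mode T -> R :=
  if w is q' :: w' then
    mode_weight_from q'
      (fun m' => \sum_m a m * mode_next_prob m q q' * update m q q' m') w'
  else a.

Definition mode_weight q w : mode T -> R :=
  mode_weight_from q (fun m => (m == init_mode T)%:R) w.

(** After a history, the distribution chosen by each mode is averaged according
    to the conditional law of the mode given the history. The other branch only
    concerns histories of probability zero. *)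
Definition fr_act q w : state M -> R := fun q' =>
  let total := \sum_m mode_weight q w m in
  if total == 0 then choose (init_mode T) (last q w) q'
  else (\sum_m mode_weight q w m * choose m (last q w) q') / total.

Lemma mode_weight_rcons q w q' m' : mode_weight q (rcons w q') m' =
  \sum_m mode_weight q w m * mode_next_prob m (last q w) q'
         * update m (last q w) q' m'.
Proof.
by rewrite /mode_weight; elim: w q (fun _ => _) => //= x w IH q a; rewrite IH.
Qed.

Lemma update_sum1 m q q' : trans q q' -> \sum_m' update m q q' m' = 1.
Proof.
move=> qq'; have [u0 _ u1] := updateP m qq'.
by apply: EFin_inj; rewrite -u1 esum_finType.
Qed.

Lemma mode_next_prob_distr m q : distribution (trans q) (mode_next_prob m q).
Proof.
by rewrite /mode_next_prob; case: ifPn => c; [exact: chooseP|exact: probP].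
Qed.

Lemma mode_weight_ge0 q w m : 0 <= mode_weight q w m.
Proof.
elim/last_ind: w m => [|w q' IH] m; first by rewrite ler0n.
rewrite mode_weight_rcons; apply: sumr_ge0 => m1 _.
have [n0 n1 _] := mode_next_prob_distr m1 (last q w).
have [t|/n1 ->] := boolP (trans (last q w) q'); last by rewrite mulr0 mul0r.
by have [u0 _ _] := updateP m1 t; rewrite !mulr_ge0.
Qed.

Lemma sum_mode_weight_rcons q w q' : \sum_m mode_weight q (rcons w q') m =
  \sum_m mode_weight q w m * mode_next_prob m (last q w) q'.
Proof.
under eq_bigr do rewrite mode_weight_rcons.
rewrite exchange_big /=; apply: eq_bigr => m _; rewrite -mulr_sumr.
have [_ n1 _] := mode_next_prob_distr m (last q w).
have [t|/n1 ->] := boolP (trans (last q w) q'); last by rewrite mulr0 mul0r.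
by rewrite update_sum1 ?mulr1.
Qed.

Lemma fr_actP q w : path trans q w -> controlled (last q w) ->
  distribution (trans (last q w)) (fr_act q w).
Proof.
move=> _ c; rewrite /fr_act; have [_|W0] := eqVneq; first exact: chooseP.
set W := \sum_m _ in W0 *.
have Wgt0 : 0 < W.
  by rewrite lt_neqAle eq_sym W0 sumr_ge0 // => m _; exact: mode_weight_ge0.
split.
- move=> q'; rewrite divr_ge0 ?(ltW Wgt0) // sumr_ge0 // => m _.
  by have [h _ _] := chooseP m c; rewrite mulr_ge0 ?mode_weight_ge0.
- move=> q' nt; rewrite big1 ?mul0r // => m _.
  by have [_ -> //] := chooseP m c; rewrite mulr0.
- under eq_esum do rewrite mulr_suml -sumEFin.
  rewrite esum_sum; last first.
    move=> q' m _ _; have [h _ _] := chooseP m c.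
    by rewrite lee_fin !mulr_ge0 ?mode_weight_ge0 // invr_ge0 ltW.
  transitivity (\sum_m (mode_weight q w m / W)%:E)%E; last first.
    by rewrite sumEFin -mulr_suml divff.
  apply: eq_bigr => m _; have [h _ h1] := chooseP m c.
  under eq_esum do rewrite mulrAC.
  rewrite esum_mulr ?h1 ?mule1 // mulr_ge0 ?mode_weight_ge0 // invr_ge0.
  exact: ltW.
Qed.

Definition fr_strategy : strategy M := Strategy fr_actP.

Lemma fr_path_prob s w : path_prob fr_strategy s w = \sum_m mode_weight s w m.
Proof.
elim/last_ind: w => [|w q IH].
  rewrite path_prob_nil /mode_weight /= (bigD1 (init_mode T)) //= eqxx.
  by rewrite big1 ?addr0 // => m /negbTE ->.
rewrite path_prob_rcons sum_mode_weight_rcons IH /next_prob /mode_next_prob.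
case: ifPn => c; last by rewrite mulr_suml.
rewrite /= /fr_act; have [W0|W0] := eqVneq; last by rewrite mulrC divfK.
rewrite W0 mul0r big1 // => m _.
have := W0 => /eqP; rewrite psumr_eq0; last by move=> ? _; exact: mode_weight_ge0.
by move=> /allP /(_ m (mem_index_enum _)) /eqP ->; rewrite mul0r.
Qed.

End FiniteMemory.

(** [ex_r i] is the random state r_(i+1), for [i >= 0]. *)
Inductive ex_state := ex_s | ex_t | ex_r of nat.

Definition ex_state_code (q : ex_state) : option (option nat) :=
  match q with ex_s => None | ex_t => Some None | ex_r i => Some (Some i) end.
Definition ex_state_decode (c : option (option nat)) : ex_state :=
  match c with None => ex_s | Some None => ex_t | Some (Some i) => ex_r i end.
Lemma ex_state_codeK : cancel ex_state_code ex_state_decode.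
Proof. by case. Qed.
HB.instance Definition _ := Countable.copy ex_state (can_type ex_state_codeK).

Section Example.
Variable R : realType.

Definition ex_controlled (q : ex_state) : bool :=
  if q is ex_r _ then false else true.

Definition ex_trans (q q' : ex_state) : bool :=
  match q, q' with
  | ex_s, ex_r _ | ex_r _, ex_t | ex_r _, ex_s | ex_t, ex_s => true
  | _, _ => false
  end.

Definition ex_prob (q q' : ex_state) : R :=
  match q, q' with
  | ex_r i, ex_t => 2 ^- i.+1
  | ex_r i, ex_s => 1 - 2 ^- i.+1
  | _, _ => 0
  end.

Definition ex_reward (q q' : ex_state) : R :=
  match q, q' with
  | ex_r _, ex_t => -1
  | ex_t, ex_s => 1
  | _, _ => 0
  end.

Lemma ex_trans_total q : exists q', ex_trans q q'.
Proof. by case: q => [||i]; [exists (ex_r 0)|exists ex_s|exists ex_s]. Qed.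

Lemma ex_probP q : ~~ ex_controlled q ->
  distribution (ex_trans q) (ex_prob q).
Proof.
case: q => // i _.
have p0 : 0 <= 2 ^- i.+1 :> R by rewrite invr_ge0 exprn_ge0.
have p1 : 2 ^- i.+1 <= 1 :> R by rewrite invf_le1 ?exprn_ege1 ?exprn_gt0 // ler1n.
split; [by case=> [||j] //=; rewrite subr_ge0|by case|].
pose a q : R := if q \in [set ex_t] then 2 ^- i.+1 else 0.
pose b q : R := if q \in [set ex_s] then 1 - 2 ^- i.+1 else 0.
have mem q q' : (q \in [set q']) = (q == q' :> ex_state).
  by apply/idP/eqP => [/set_mem|->]; [|exact: mem_set].
transitivity (\esum_(q in [set: ex_state]) ((a q)%:E + (b q)%:E))%E.
  apply: eq_esum => q _; rewrite /a /b !mem -EFinD.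
  by case: q => [||j] /=; rewrite ?addr0 ?add0r.
rewrite esumD; last 2 first.
- by move=> q _; rewrite lee_fin /a; case: ifP.
- by move=> q _; rewrite lee_fin /b; case: ifP; rewrite ?subr_ge0.
have -> : (\esum_(q in [set: ex_state]) (a q)%:E = (2 ^- i.+1)%:E)%E.
  rewrite -(@esum_set1 _ _ ex_t (fun=> (2 ^- i.+1)%:E)) ?lee_fin // [RHS]esum_mkcond.
  by apply: eq_esum => q _; rewrite /a; case: ifP.
have -> : (\esum_(q in [set: ex_state]) (b q)%:E = (1 - 2 ^- i.+1)%:E)%E.
  rewrite -(@esum_set1 _ _ ex_s (fun=> (1 - 2 ^- i.+1)%:E)) ?lee_fin ?subr_ge0 //.
  rewrite [RHS]esum_mkcond; by apply: eq_esum => q _; rewrite /b; case: ifP.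
by rewrite -EFinD addrC subrK.
Qed.

Definition ex_mdp : mdp R :=
  @Mdp R ex_state ex_controlled ex_trans ex_prob ex_reward
    ex_trans_total ex_probP.

Definition ex_phi : set (run_space (ex_s : state ex_mdp)) :=
  @liminf_reward_ge0 R ex_mdp ex_s.

End Example.

Arguments ex_phi R : clear implicits.

(* Main.v *)
(** A run wins iff it visits [t] finitely often. Under a finite-memory strategy
    there are finitely many distributions to play at [s], so all of them put mass
    at least [delta > 0] on the first [k] random states, for common [delta] and
    [k]; each visit to [s] is then followed by [t] with conditional probability
    at least [delta * 2 ^- k], and [t] is visited infinitely often almost surely.
    Conversely, the strategy moving to [ex_r n] at time [n] visits [t] at time [n + 2]
    with probability at most [2 ^- n.+1], which is summable, so Borel-Cantelli
    applies. *)

Require Import Defs.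
From mathcomp Require Import all_boot all_order all_algebra.
From mathcomp Require Import all_classical all_reals all_analysis.
From mathcomp Require Import measurable_realfun.
Import Order.TTheory GRing.Theory Num.Theory numFieldNormedType.Exports.
Local Open Scope classical_set_scope.
Local Open Scope ring_scope.
Set Implicit Arguments.
Unset Strict Implicit.

(** * Nonnegativity of a liminf as eventual lower bounds *)

Lemma limn_einf_ge0P (R : realType) (u : nat -> R) :
  (0 <= limn_einf (fun n => (u n)%:E))%E <->
  forall e : R, 0 < e -> exists N, forall n, (N <= n)%N -> - e <= u n.
Proof.
rewrite limn_einf_lim (cvg_lim _ (@cvg_einfs_sup _ _)) //; split=> [u0 e e0|h].
- have : ((- e)%:E < ereal_sup (range (einfs (fun n => (u n)%:E))))%E.
    by apply: lt_le_trans u0; rewrite lte_fin oppr_lt0.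
  move=> /ereal_sup_gt[_ [N _ <-]] /ltW le; exists N => n Nn.
  rewrite -lee_fin (le_trans le) //; apply: ereal_inf_lbound.
  by exists n.
- apply/lee_addgt0Pr => e e0; have [N hN] := h e e0.
  rewrite -leeBlDr // sub0e -EFinN.
  apply: (@le_trans _ _ (einfs (fun n => (u n)%:E) N)); last first.
    by apply: ereal_sup_ubound; exists N.
  by apply: le_ereal_inf_tmp => _ [n /= Nn <-]; rewrite lee_fin hN.
Qed.

(** * Events on the space of runs and their probabilities *)

Section RunMeasure.
Variables (R : realType) (M : mdp R).
Implicit Types (s : state M) (w : seq (state M)).

Lemma run_path s (rho : run s) w :
  cylinder s w rho -> path trans s w.
Proof.
move=> h; apply/(pathP s) => i iw; change (mkseq rho (size w).+1 = s :: w) in h.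
have -> : nth s w i = nth s (s :: w) i.+1 by [].
by rewrite -h !nth_mkseq ?run_trans // ltnS ltnW.
Qed.

Lemma cylinder_nth s w (rho : run s) i :
  cylinder s w rho -> (i <= size w)%N -> rho i = nth s (s :: w) i.
Proof.
move=> h iw; change (mkseq rho (size w).+1 = s :: w) in h.
by rewrite -h nth_mkseq.
Qed.

Lemma cylinder_rcons s w q (rho : run s) :
  cylinder s (rcons w q) rho <-> cylinder s w rho /\ rho (size w).+1 = q.
Proof.
change (mkseq rho (size (rcons w q)).+1 = s :: rcons w q <->
  mkseq rho (size w).+1 = s :: w /\ rho (size w).+1 = q).
rewrite size_rcons mkseqS -rcons_cons; split=> [/rcons_inj e|[-> ->]//].
by split; [exact: (congr1 fst e)|exact: (congr1 snd e)].
Qed.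

Lemma measurable_run_at s n (A : set (state M)) :
  measurable ([set rho : run s | A (rho n)] : set (run_space s)).
Proof.
have -> : [set rho : run s | A (rho n)] =
    [set rho : run s | [set w | A (nth s w n)] (mkseq rho n.+1)].
  by apply/seteqP; split=> rho /=; rewrite nth_mkseq.
exact: measurable_prefix.
Qed.

(** The cylinders of length [n] partition the runs into countably many pieces, so a bound that holds
    on each piece sums up. This stands in for conditioning on the first [n] steps. *)
Lemma le_run_prob_cylinders (sigma : strategy M) s n (c : R)
    (A B : set (run_space s)) : 0 <= c -> measurable A -> measurable B ->
  (forall w, size w = n -> (run_prob sigma s (cylinder s w `&` A) <=
     c%:E * run_prob sigma s (cylinder s w `&` B))%E) ->
  (run_prob sigma s A <= c%:E * run_prob sigma s B)%E.
Proof.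
move=> c0 mA mB AB; set P := run_prob sigma s in AB *.
(* Words are enumerated by their codes; a number that codes no word of length [n] gets the empty
   set. *)
pose C k : set (run_space s) := if pickle_inv k is Some w then
  if size w == n then cylinder s w else set0 else set0.
have mC k : measurable (C k).
  rewrite /C; case: pickle_inv => [w|//]; case: ifP => // _.
  exact: measurable_cylinder.
have tC : trivIset setT C.
  move=> i j _ _ [rho []]; rewrite /C.
  have := @pickle_invK (seq (state M)) i.
  have := @pickle_invK (seq (state M)) j.
  case: pickle_inv => [w|//]; case: pickle_inv => [w'|//] /= <- <-.
  case: eqP => // sw; case: eqP => // sw'.
  move=> h h'; change (mkseq (rho : run s) (size w').+1 = s :: w') in h.
  change (mkseq (rho : run s) (size w).+1 = s :: w) in h'.
  by move: h'; rewrite sw' -sw h => -[->].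
have split_cylinders D : measurable D -> P D = (\sum_(0 <= k <oo) P (C k `&` D))%E.
  move=> mD; rewrite -measure_semi_bigcup //; last 3 first.
  - by move=> k; apply: measurableI.
  - by apply/trivIset_setIr.
  - by apply: bigcup_measurable => k _; apply: measurableI.
  congr (P _); rewrite -setI_bigcupl [RHS]setIidr // => rho _.
  pose w := behead (mkseq (rho : run s) n.+1).
  have sw : size w = n by rewrite size_behead size_mkseq.
  exists (pickle w) => //; rewrite /C pickleK_inv sw eqxx.
  change (mkseq (rho : run s) (size w).+1 = s :: w).
  by rewrite sw /w /mkseq /= run_start.
rewrite (split_cylinders _ mA) (split_cylinders _ mB) -nneseriesZl //.
apply: lee_nneseries => // k _; rewrite /C.
case: pickle_inv => [w|]; last by rewrite !set0I !measure0 mule0.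
case: eqP => [|_]; first exact: AB.
by rewrite !set0I !measure0 mule0.
Qed.

End RunMeasure.

(** * The objective as finitely many visits to [t] *)

Section Example.
Variable R : realType.
Local Notation M := (ex_mdp R).
Local Notation s0 := (ex_s : state M).
Local Notation t0 := (ex_t : state M).
Local Notation r := (ex_r : nat -> state M).

Lemma ex_phiP (rho : run s0) :
  ex_phi R rho <-> exists N, forall n, (N <= n)%N -> rho n != t0.
Proof.
apply: (iff_trans (@limn_einf_ge0P R (fun n => ex_reward R (rho n) (rho n.+1)))).
split=> [h|[N hN] e e0].
(* Only entering [t] has a reward below [-1/2], so from some time on [t] is not entered. Transition
   [n] leads to the state at [n.+1], whence the bound [N.+1]. *)
- have [|N hN] := h 2^-1; first by rewrite invr_gt0.
  exists N.+1 => -[//|n]; rewrite ltnS => /hN {hN}.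
  apply: contraTneq => rt; have := @run_trans R M s0 rho n; rewrite rt.
  case: (run_at _ n) => // i _ /=.
  by rewrite -ltNge ltrN2 invf_lt1 // ltr1n.
- exists N => n /leqW /hN; case: (rho n.+1) => [||i]; case: (rho n) => [||j] //= _;
  by rewrite ?oppr_le0 ?(ltW e0) // (@le_trans _ _ 0) // oppr_le0 ltW.
Qed.

(** Away from [t], a visit to [s] is followed by a random state and then by [s] again: a round takes
    two steps. *)
Lemma ex_t_avoiding_s (rho : run s0) n k :
  rho n = s0 -> (forall j, (j <= k.*2)%N -> rho (n + j)%N != t0) ->
  rho (n + k.*2)%N = s0.
Proof.
move=> rn; elim: k => [|k IH] h; first by rewrite addn0.
have {}IH := IH (fun j jk => h j (leqW (leqW jk))).
have := @run_trans R M s0 rho (n + k.*2); rewrite IH.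
have := @run_trans R M s0 rho (n + k.*2).+1.
have := h k.*2.+2 (leqnn _); rewrite !addnS.
by case: (run_at _ (n + k.*2).+2) => [||i] //; case: (run_at _ (n + k.*2).+1).
Qed.

Definition ex_t_avoided n k : set (run_space s0) :=
  [set rho : run s0 | rho n = s0] `&`
  \bigcap_(j in [set j | (j <= k.*2)%N]) [set rho : run s0 | rho (n + j)%N != t0].

Lemma measurable_ex_t_avoided n k : measurable (ex_t_avoided n k).
Proof.
apply: measurableI; first exact: (measurable_run_at n [set s0]).
apply: bigcap_measurable => [|j _]; first by exists 0%N.
exact: (measurable_run_at (n + j) [set q | q != t0]).
Qed.

(** Once [t] is no longer visited, the run is at [s] at time [N] or [N.+1]. The union is countable,
    so it will suffice that each intersection is null. *)
Lemma ex_phi_sub_avoided : ex_phi R `<=` \bigcup_n \bigcap_k ex_t_avoided n k.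
Proof.
move=> rho /ex_phiP[N hN].
have [m Nm rm] : exists2 m, (N <= m)%N & (rho : run s0) m = s0.
  have := @run_trans R M s0 rho N; have := hN N (leqnn N); have := hN _ (leqnSn N).
  case E : (rho N) => [||i]; [by exists N|by []|].
  case E' : (rho N.+1) => [||j] // _ _ _; by exists N.+1.
by exists m => // k _; split=> // j _; apply: hN; rewrite (leq_trans Nm) ?leq_addr.
Qed.

(** The [k] cylinders that enter [t] through some [r i] are disjoint, lie in the cylinder of [w] and
    miss [A]. *)
Lemma run_prob_avoid_t_le (sigma : strategy M) w (k : nat)
    (A : set (run_space s0)) :
  measurable A -> A `<=` cylinder s0 w ->
  (forall rho : run s0, A rho -> rho (size w).+2 != t0) ->
  (run_prob sigma s0 A <= run_prob sigma s0 (cylinder s0 w) -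
     \sum_(i < k) run_prob sigma s0 (cylinder s0 (rcons (rcons w (r i)) t0)))%E.
Proof.
move=> mA Aw At; set P := run_prob sigma s0.
pose F i : set (run_space s0) := cylinder s0 (rcons (rcons w (r i)) t0).
have mF i : measurable (F i) by exact: measurable_cylinder.
rewrite -(@measure_bigsetU _ _ _ P F) //; last first.
  move=> i j _ _ [rho []] /cylinder_rcons[/cylinder_rcons[_ ei] _].
  by move=> /cylinder_rcons[/cylinder_rcons[_]]; rewrite ei => -[].
set U := \big[setU/set0]_(i < k) F i.
have mU : measurable U by apply: bigsetU_measurable.
have PU : P U \is a fin_num by exact: fin_num_measure.
rewrite leeBrDr // -measureU //.
- apply: le_measure; rewrite ?inE; first exact: measurableU.
    exact: measurable_cylinder.
  rewrite subUset; split=> // rho; rewrite /U -bigcup_mkord => -[i _].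
  by move=> /cylinder_rcons[/cylinder_rcons[]].
- apply/seteqP; split=> // rho [/At + ]; rewrite /U -bigcup_mkord => + [i _].
  by move=> /[swap] /cylinder_rcons[_]; rewrite size_rcons => ->; rewrite eqxx.
Qed.

(** * Geometric decay when the first [k] random states always get mass [delta] *)

Section HitBoundedBelow.
Variables (sigma : strategy M) (k : nat) (delta : R).
Hypothesis delta01 : 0 < delta <= 1.
Hypothesis sigma_delta : forall w, path trans s0 w -> last s0 w = s0 ->
  delta <= \sum_(i < k) sigma s0 w (r i).
Let P := run_prob sigma s0.
(** Bound on the conditional probability that a round starting at [s] avoids [t]. *)
Let c : R := 1 - delta * 2 ^- k.

Let c01 : 0 <= c < 1.
Proof.
have /andP[d0 d1] := delta01; have p0 : 0 < 2 ^- k :> R by rewrite invr_gt0 exprn_gt0.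
rewrite subr_ge0 mulr_ile1 ?(ltW d0) ?(ltW p0) //=; last first.
  by rewrite invf_le1 ?exprn_gt0 // exprn_ege1 // ler1n.
by rewrite ltrBlDl ltrDr mulr_gt0.
Qed.

(** Each [r i] with [i < k] moves to [t] with probability [2 ^- i.+1], which is at least
    [2 ^- k]. *)
Let delta_le_sum w : path trans s0 w -> last s0 w = s0 ->
  path_prob sigma s0 w * (1 - c) <=
    \sum_(i < k) path_prob sigma s0 (rcons (rcons w (r i)) t0).
Proof.
move=> pw lw; rewrite opprB addrC subrK.
apply: (@le_trans _ _ (path_prob sigma s0 w * ((\sum_(i < k) sigma s0 w (r i)) * 2 ^- k))).
  rewrite ler_wpM2l ?path_prob_ge0 // ler_wpM2r ?invr_ge0 ?exprn_ge0 //.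
  exact: sigma_delta.
rewrite mulr_suml mulr_sumr; apply: ler_sum => i _.
rewrite !path_prob_rcons -mulrA /next_prob last_rcons lw /=.
have [sg0 _ _] : Defs.distribution (trans (last s0 w)) (sigma s0 w).
  by apply: actP => //; rewrite lw.
rewrite !ler_wpM2l ?path_prob_ge0 ?sg0 //.
by rewrite lef_pV2 ?posrE ?exprn_gt0 // ler_eXn2l // ltr1n.
Qed.

Let avoided_decay n j :
  (P (ex_t_avoided n j.+1) <= c%:E * P (ex_t_avoided n j))%E.
Proof.
have /andP[c0 c1] := c01.
have subS : ex_t_avoided n j.+1 `<=` ex_t_avoided n j.
  move=> rho [rn av]; split=> // i /= ij; apply: av => /=.
  by rewrite (leq_trans ij) // leq_double.
(* A path of this length determines every state that [ex_t_avoided n j] inspects, so each cylinder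
   lies inside this event or is disjoint from it. *)
apply: (@le_run_prob_cylinders _ _ _ _ (n + j.*2)) => //;
  do ?exact: measurable_ex_t_avoided.
move=> w sw; have [[rho0 [cw [rn av]]]|none] :=
    pselect ((cylinder s0 w `&` ex_t_avoided n j) !=set0); last first.
  rewrite (_ : _ `&` ex_t_avoided n j.+1 = set0) ?measure0 ?mule_ge0 ?lee_fin //.
  by apply/seteqP; split=> // rho [cw /subS a]; case: none; exists rho.
have pw := run_path cw.
have lw : last s0 w = s0.
  rewrite (last_nth s0) -(cylinder_nth cw) // sw.
  exact: (ex_t_avoiding_s rn).
rewrite [X in (_ <= _ * P X)%E]setIidl; last first.
  have eqr (rho : run s0) i : cylinder s0 w rho -> (i <= n + j.*2)%N -> rho i = rho0 i.
    by move=> h ij; rewrite (cylinder_nth h) ?sw // (cylinder_nth cw) ?sw.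
  move=> rho h; split; first by rewrite /= (eqr _ _ h) ?leq_addr.
  by move=> i ij; rewrite /= (eqr _ _ h) ?leq_add2l //; exact: av.
apply: le_trans.
  apply: (@run_prob_avoid_t_le sigma w k).
- apply: measurableI; [exact: measurable_cylinder|exact: measurable_ex_t_avoided].
- by move=> rho [].
(* The time [(size w).+2] is the last one checked by the window of [j.+1] rounds. *)
- move=> rho [_ [_ avr]]; have := avr j.+1.*2 (leqnn _).
  by rewrite sw doubleS /= !addnS.
under eq_bigr do rewrite run_prob_cylinder.
rewrite /P run_prob_cylinder sumEFin -EFinB -EFinM lee_fin.
have := delta_le_sum pw lw.
rewrite mulrBr mulr1 [c * _]mulrC lerBlDr addrC -lerBlDr.
by [].
Qed.

Lemma run_prob_ex_phi0 : run_prob sigma s0 (ex_phi R) = 0%E.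
Proof.
have /andP[c0 c1] := c01.
have mA n : measurable (\bigcap_j ex_t_avoided n j).
  by apply: bigcapT_measurable => j; exact: measurable_ex_t_avoided.
have null n : P (\bigcap_j ex_t_avoided n j) = 0%E.
  have bnd j : (P (ex_t_avoided n j) <= (c ^+ j)%:E)%E.
    elim: j => [|j IH]; first by rewrite expr0 probability_le1 //; exact: measurable_ex_t_avoided.
    apply: (le_trans (avoided_decay n j)).
    by rewrite exprS EFinM lee_wpmul2l ?lee_fin.
  apply/eqP; rewrite eq_le measure_ge0 andbT.
  rewrite -(fineK (fin_num_measure P _ (mA n))) lee_fin.
  (* The probability is at most [c ^+ j] for every [j], hence at most the limit 0. *)
  apply: (@cvgr_to_ge _ \oo _ _ (GRing.exp c)).
    by apply: cvg_expr; rewrite ger0_norm.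
  apply: nearW => j; rewrite -lee_fin fineK ?fin_num_measure //.
  apply: le_trans (bnd j); apply: le_measure; rewrite ?inE //.
    exact: measurable_ex_t_avoided.
  exact: bigcap_inf.
have : P.-negligible (\bigcup_n \bigcap_j ex_t_avoided n j).
  by apply: negligible_bigcup => n; apply/negligibleP; [exact: mA|exact: null].
move=> /(negligibleS ex_phi_sub_avoided).
move=> /measure_negligible -> //; exact: measurable_liminf_reward_ge0.
Qed.

End HitBoundedBelow.

(** * A common lower bound for finitely many modes *)

Lemma choose_r_gt0 (T : fr_memory M) (m : mode T) : exists i, 0 < Defs.choose m s0 (r i).
Proof.
have [ch0 chr ch1] := Defs.chooseP m (isT : controlled s0).
apply: contrapT => /forallNP none; move: ch1; rewrite esum1 => [/eqP|q _].
  by rewrite eq_sym onee_eq0.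
congr EFin; case: q => [||i]; [exact: chr|exact: chr|].
by apply/eqP; rewrite eq_le ch0 andbT leNgt; apply/negP/none.
Qed.

Lemma choose_r_sum_ge (T : fr_memory M) : exists (k : nat) (delta : R),
  0 < delta <= 1 /\ forall m : mode T, delta <= \sum_(i < k) Defs.choose m s0 (r i).
Proof.
have [f f0] := choice (@choose_r_gt0 T).
(* [k] exceeds the index picked for each mode and [delta] is the least of the picked masses; the
   default 1 of the minimum gives [delta <= 1]. *)
exists (\max_m (f m).+1), (\big[Order.min/1]_m Defs.choose m s0 (r (f m))).
split=> [|m]; first by rewrite bigmin_le_id andbT; apply: lt_bigmin.
apply: (le_trans (bigmin_le_cond _ _ (isT : xpredT m))).
have fk : (f m < \max_m (f m).+1)%N := leq_bigmax m.
have [ch0 _ _] := Defs.chooseP m (isT : controlled s0).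
by rewrite (bigD1 (Ordinal fk)) //= lerDl sumr_ge0.
Qed.

(** At [s] the strategy plays an average of the distributions of the modes, or that of the initial
    mode on null histories, so a bound common to all modes passes to it. *)
Lemma fr_strategy_r_sum_ge (T : fr_memory M) (k : nat) (delta : R) w :
  (forall m : mode T, delta <= \sum_(i < k) Defs.choose m s0 (r i)) ->
  last s0 w = s0 -> delta <= \sum_(i < k) fr_strategy T s0 w (r i).
Proof.
move=> hd lw; rewrite /= /fr_act lw; have [_|W0] := eqVneq; first exact: hd.
have Wgt0 : 0 < \sum_m mode_weight (T:=T) s0 w m.
  by rewrite lt_neqAle eq_sym W0 sumr_ge0 // => m _; exact: mode_weight_ge0.
rewrite -mulr_suml ler_pdivlMr // exchange_big mulr_sumr /=; apply: ler_sum => m _.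
by rewrite -mulr_sumr mulrC ler_wpM2l ?mode_weight_ge0.
Qed.

(** * An almost surely winning strategy with infinite memory *)

(** Time, i.e. the length of the history, serves as the unbounded memory. *)
Definition ex_act (q : state M) (w : seq (state M)) (q' : state M) : R :=
  (q' == if last q w == s0 then r (size w) else s0)%:R.

Lemma ex_actP q w : path trans q w -> controlled (last q w) ->
  Defs.distribution (trans (last q w)) (ex_act q w).
Proof.
move=> _ cw; rewrite /ex_act; set q1 := if _ then _ else _.
split=> [q'|q'|]; first exact: ler0n.
- case: eqP => // ->; rewrite /q1; case: (last q w) cw => //.
- transitivity (\esum_(q' in [set q1]) (1 : R)%:E)%E; last by rewrite esum_set1 ?lee_fin.
  rewrite [RHS]esum_mkcond; apply: eq_esum => q' _.
  case: ifPn => [/set_mem ->|/negP nq]; first by rewrite eqxx.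
  by case: eqP => // e; case: nq; exact/mem_set.
Qed.

Definition ex_strategy : strategy M := Strategy ex_actP.

(** A path of positive probability from which [t] can be entered ends in [r i] with [i.+1 = size w],
    since the strategy moves to [r i] only after [i] steps. *)
Lemma ex_strategy_hit w :
  path_prob ex_strategy s0 (rcons w t0) <= 2 ^- size w * path_prob ex_strategy s0 w.
Proof.
rewrite path_prob_rcons mulrC.
have [->|w0] := eqVneq (path_prob ex_strategy s0 w) 0; first by rewrite !mulr0.
rewrite ler_wpM2r ?path_prob_ge0 //.
have [_ tr _] := next_prob_distr ex_strategy (path_prob_path w0).
have [tw|/tr ->] := boolP (trans (last s0 w) t0); last first.
  by rewrite invr_ge0 exprn_ge0.
case/lastP: w => [|w q] in w0 tr tw *; first by [].
move: w0 tw {tr}; rewrite path_prob_rcons mulf_eq0 negb_or => /andP[_].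
rewrite last_rcons; case: q => // i + _; rewrite /next_prob last_rcons size_rcons /=.
case E: (last s0 w) => [||j] /=; rewrite ?eqxx // /ex_act E /= ?eqxx //.
by case: (r i =P r (size w)) => [[->]|_]; rewrite ?eqxx ?lexx.
Qed.

Lemma run_prob_ex_phi1 : run_prob ex_strategy s0 (ex_phi R) = 1%E.
Proof.
set P := run_prob _ _.
pose H n : set (run_space s0) := [set rho : run s0 | rho n.+1 = t0].
have mH n : measurable (H n) by exact: (measurable_run_at n.+1 [set t0]).
have PH n : (P (H n) <= (2 ^- n)%:E)%E.
  (* With the whole space on the right, the bound on cylinders becomes a bound on [H n]. *)
  rewrite -[leRHS]mule1 -(probability_setT P).
  apply: (@le_run_prob_cylinders _ _ _ _ n) => [|//|//|w sw].
    by rewrite invr_ge0 exprn_ge0.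
  rewrite setIT (_ : _ `&` _ = cylinder s0 (rcons w t0)); last first.
    by apply/seteqP; split=> rho; rewrite cylinder_rcons sw.
  by rewrite /P !run_prob_cylinder -EFinM lee_fin -sw ex_strategy_hit.
have H0 : P (lim_sup_set H) = 0%E.
  apply: lim_sup_set_cvg0 => //.
  (* [2 ^- n] is read as [2 / 2 ^+ n.+1], a term of the geometric series with sum [2 / 2 ^+ 0]. *)
  apply: (@le_lt_trans _ _ (2 / 2 ^+ 0)%:E); last exact: ltry.
  rewrite -(cvg_lim _ (@cvg_geometric_eseries_half R 2 0)) //.
  apply: lee_nneseries => // n _; rewrite (le_trans (PH n)) // lee_fin.
  by rewrite natrX addn1 exprS invfM mulrA divff // mul1r.
(* [H n] concerns time [n.+1]; leaving out time 0 does not change whether [t] is visited infinitely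
   often. *)
have -> : ex_phi R = ~` lim_sup_set H.
  apply/seteqP; split=> rho.
    by move/ex_phiP => [N hN] /(_ N I)[n /= Nn]; apply/eqP/hN/(leq_trans Nn).
  move=> nl; apply/ex_phiP; apply: contrapT => inf; apply: nl => N _.
  apply: contrapT => none; apply: inf; exists N.+1 => -[//|n] Nn.
  by apply/eqP => e; apply: none; exists n.
rewrite probability_setC; first by rewrite H0 sube0.
by apply: bigcapT_measurable => n; apply: bigcup_measurable.
Qed.

End Example.

(** * Both halves combined, with the consequences for optimality *)

Theorem proposition33 (R : realType) :
  (forall T : fr_memory (ex_mdp R),
     run_prob (fr_strategy T) ex_s (ex_phi R) = 0%E) /\
  (exists sigma : strategy (ex_mdp R),
     run_prob sigma ex_s (ex_phi R) = 1%E) /\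
  ((exists sigma : strategy (ex_mdp R),
      almost_surely_winning (ex_phi R) sigma /\ optimal (ex_phi R) sigma) /\
   (forall T : fr_memory (ex_mdp R),
      ~ almost_surely_winning (ex_phi R) (fr_strategy T) /\
      ~ optimal (ex_phi R) (fr_strategy T)) /\
   (forall eps : R, 0 < eps < 1 ->
      (exists sigma : strategy (ex_mdp R),
         eps_optimal (ex_phi R) eps sigma) /\
      (forall T : fr_memory (ex_mdp R),
         ~ eps_optimal (ex_phi R) eps (fr_strategy T)))).
Proof.
have fr0 (T : fr_memory (ex_mdp R)) : run_prob (fr_strategy T) ex_s (ex_phi R) = 0%E.
  have [k [delta [delta01 hd]]] := choose_r_sum_ge T.
  apply: (run_prob_ex_phi0 delta01) => w _; exact: fr_strategy_r_sum_ge hd.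
have win := run_prob_ex_phi1 R.
(* With value 1, a strategy of winning probability 0 is not optimal, nor [eps]-optimal when
   [eps < 1]. *)
have val1 : value (ex_phi R) = 1%E.
  apply/eqP; rewrite eq_le; apply/andP; split.
    apply: ge_ereal_sup => _ [sigma _ <-].
    by apply: probability_le1; exact: measurable_liminf_reward_ge0.
  by rewrite -win; apply: ereal_sup_ubound; exists (ex_strategy R).
rewrite /almost_surely_winning /optimal /eps_optimal val1.
split=> //; split; first by exists (ex_strategy R).
split; first by exists (ex_strategy R).
split=> [T|eps /andP[eps0 eps1]].
  by rewrite fr0; split => /esym/eqP; rewrite onee_eq0.
split=> [|T].
  by exists (ex_strategy R); rewrite win -EFinB lee_fin gerBl ltW.
by rewrite fr0 -EFinB lee_fin subr_le0 leNgt eps1.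
Qed.
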